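(* Let $\beta>0$, let $k_n\ge 0$ satisfy $k_n=o(n^{\beta})$ as $n\to\infty$, and let $\alpha_n(k_n)=P\{L_n(\boldsymbol{D})>k_n\}$, where $L_n(\boldsymbol{D})$ is the optimal value of the dual linear program with demand vector $\boldsymbol{D}$ and supplies $s_n(t_i)=n^{\beta}\gamma(t_i)$. For each $n$ let $Q=Q_n$ be the probability law of $\boldsymbol{D}$ on $\mathbb{R}^d$ given, for Borel sets $B\subset\mathbb{R}^d$, by $$Q\{\boldsymbol{D}\in B\}=\sum_{i=1}^{d}p(i)\,P\{\boldsymbol{D}\in B\mid D(t_i)-s_n(t_i)>0\},\qquad p(i)=\frac{P\{D(t_i)-s_n(t_i)>0\}}{\sum_{j=1}^{d}P\{D(t_j)-s_n(t_j)>0\}}.$$ Then $$Z_n(\boldsymbol{D})=\frac{dP}{dQ}\,I\{L_n(\boldsymbol{D})>k_n\}=\frac{\sum_{j=1}^{d}P\{D(t_j)-s_n(t_j)>0\}}{\sum_{j=1}^{d}I\{D(t_j)-s_n(t_j)>0\}}\,I\{L_n(\boldsymbol{D})>k_n\},$$ with $\boldsymbol{D}$ sampled from $Q$, is an asymptotically optimal estimator for $\alpha_n(k_n)$.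
   Context: Network: $G=(V,E)$ is a directed graph with $V=\{1,\dots,d\}$ ($d$ fixed) and incidence matrix $H$, where $H(i,j)=1$ if $(i,j)\in E$, $H(i,j)=0$ otherwise, and $H(i,i)=0$ for all $i$; $H$ is assumed irreducible. The matrix $A=(a_{ij})_{i,j\in V}$ satisfies $a_{ij}=0$ if $H(i,j)=0$, $a_{ij}>0$ if $H(i,j)=1$, and $\sum_{j=1}^d a_{ij}=1$ for every $i$. Supplies and demands: $T=\{t_1,\dots,t_d\}$ is the set of node locations; $\gamma,\mu,\sigma$ are fixed positive functions on $T$, and $\sigma^2(\cdot,\cdot)$ is a fixed function on $T\times T$ with $\sigma^2(t,t)=\sigma^2(t)$. The rarity parameter $n$ ranges over the positive integers. The node at location $t_i$ has deterministic supply $s_n(t_i)=n^\beta\gamma(t_i)$; put $\boldsymbol{s}_n=(s_n(t_1),\dots,s_n(t_d))'$. Under $P$, the demand vector $\boldsymbol{D}=(D(t_1),\dots,D(t_d))'$ does not depend on $n$ and is jointly Gaussian with $D(t_i)\sim N(\mu(t_i),\sigma^2(t_i))$ and $\mathrm{cov}[D(t_i),D(t_j)]=\sigma^2(t_i,t_j)$; its covariance matrix $\Sigma$ is symmetric positive definite. (The model also assumes that each node's expected demand is at most its supply; here this holds automatically for all large $n$.) Dual linear program: $L_n(\boldsymbol{D})=\sup\{\boldsymbol{y}'(\boldsymbol{D}-\boldsymbol{s}_n):\ \boldsymbol{y}\in\mathbb{R}^d,\ (I-A)\boldsymbol{y}\le\boldsymbol{1},\ \boldsymbol{y}\ge\boldsymbol{0}\}\in[0,\infty]$,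 where in this formula $I$ is the identity matrix, inequalities are componentwise, $\boldsymbol{1}$ is the all-ones vector, and the value is $+\infty$ if the program is unbounded. Elsewhere $I\{\cdot\}$ denotes the indicator of an event. Asymptotic optimality: a collection $(Z_n)$ of estimators for $\rho(n)$ is asymptotically optimal if $E[Z_n]=\rho(n)$ for all $n$ and $\sup_{n>0}\frac{E(Z_n^2)}{\rho(n)^{2-\epsilon}}<\infty$ for every $\epsilon>0$. Here the expectations are taken under $Q=Q_n$ and $\rho(n)=\alpha_n(k_n)$. $f(n)=o(g(n))$ means that for every $C>0$ there is $N$ such that $|f(n)|<C|g(n)|$ for all $n>N$. *)

(* Defs.v *)
From mathcomp Require Import all_boot all_order all_algebra.
From mathcomp Require Import all_classical all_reals all_analysis.

Set Implicit Arguments.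
Unset Strict Implicit.
Unset Printing Implicit Defensive.

Import Order.TTheory GRing.Theory Num.Theory.
Import numFieldNormedType.Exports.

Local Open Scope classical_set_scope.
Local Open Scope ring_scope.

Definition little_o (R : realType) (f g : nat -> R) : Prop :=
  forall C : R, 0 < C ->
    exists N : nat, forall n : nat, (N < n)%N -> `|f n| < C * `|g n|.

Definition incidence_mx (R : realType) (d : nat) (edge : rel 'I_d) : 'M[R]_d :=
  \matrix_(i, j) (edge i j)%:R.

(* For a matrix with nonnegative entries. *)
Definition irreducible_mx (R : realType) (d : nat) (M : 'M[R]_d) : Prop :=
  forall i j : 'I_d, exists2 k : nat, (0 < k)%N & 0 < (M ^+ k) i j.

Definition spd_mx (R : realType) (d : nat) (M : 'M[R]_d) : Prop :=
  M^T = M /\ forall x : 'cV[R]_d, x != 0 -> 0 < (x^T *m M *m x) 0 0.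

Section random_vectors.
Context (disp : measure_display) (Omega : measurableType disp) (R : realType)
  (P : probability Omega R).

Definition has_law (X : Omega -> R) (m : set R -> \bar R) : Prop :=
  forall A : set R, measurable A -> P (X @^-1` A) = m A.

(* Every linear combination of the coordinates is Gaussian; the degenerate
   Gaussian laws appear as Dirac masses because normal_prob m 0 is not one. *)
Definition jointly_gaussian (d : nat) (D : Omega -> d.-tuple R) : Prop :=
  forall a : 'I_d -> R,
    let X := fun w => \sum_i a i * tnth (D w) i in
    (exists m s : R, 0 < s /\ has_law X (normal_prob m s)) \/
    (exists m : R, has_law X (\d_m : set R -> \bar R)).

End random_vectors.

Section change_of_measure.
Context (disp : measure_display) (T : measurableType disp) (R : realType).

Definition cond_prob (mu : probability T R) (A B : set T) : \bar R :=
  (mu (A `&` B) / mu B)%E.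

Lemma probability_lty (mu : probability T R) (A : set T) :
  measurable A -> (mu A < +oo)%E.
Proof.
by move=> mA; rewrite (le_lt_trans (probability_le1 mu mA))// ltry.
Qed.

(* The likelihood ratio of mu with respect to nu agrees with f on E. Only the
   restriction of mu to E has to be dominated by nu: the Radon-Nikodym
   derivative of this restriction is (d mu / d nu) * \1_E. *)
Definition density_on (mu nu : probability T R) (E : set T) (f : T -> R) :
    Prop :=
  exists mE : measurable E,
    let mu_E := mfrestr mE (probability_lty mu mE) in
    mu_E `<< nu /\
    ae_eq nu [set: T]
      (Radon_Nikodym (charge_of_finite_measure mu_E) nu)
      (fun x => (f x * \1_E x)%:E).

Definition asymptotically_optimal (Q : nat -> probability T R)
    (Z : nat -> T -> R) (rho : nat -> R) : Prop :=
  (forall n : nat, (0 < n)%N ->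
     measurable_fun [set: T] (Z n) /\ 'E_(Q n)[Z n]%E = (rho n)%:E) /\
  (forall eps : R, 0 < eps ->
     (ereal_sup [set 'E_(Q n)[(fun x => (Z n x) ^+ 2)%R]
                       / (rho n `^ (2 - eps))%:E
                | n in [set n : nat | (0 < n)%N]] < +oo)%E).

End change_of_measure.

Section network.
Context (R : realType) (d : nat).

Definition supply (beta : R) (gamma : 'I_d -> R) (n : nat) : 'cV[R]_d :=
  \col_i (n%:R `^ beta * gamma i).

Definition dual_feasible (A : 'M[R]_d) : set 'cV[R]_d :=
  [set y | (forall i, ((1%:M - A) *m y) i 0 <= 1) /\ (forall i, 0 <= y i 0)].

(* The value is +oo when the program is unbounded. *)
Definition dual_value (A : 'M[R]_d) (s : 'cV[R]_d) (x : d.-tuple R) : \bar R :=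
  ereal_sup [set ((y^T *m (\col_i tnth x i - s)) 0 0)%:E
            | y in dual_feasible A].

Definition loss_event (A : 'M[R]_d) (s : 'cV[R]_d) (k : R) :
    set (d.-tuple R) :=
  [set x | (k%:E < dual_value A s x)%E].

Definition overload (s : 'cV[R]_d) (i : 'I_d) : set (d.-tuple R) :=
  [set x | 0 < tnth x i - s i 0].

Definition mixture_weight (law : probability (d.-tuple R) R) (s : 'cV[R]_d)
    (i : 'I_d) : \bar R :=
  (law (overload s i) / \sum_j law (overload s j))%E.

Definition is_mixture (law : probability (d.-tuple R) R) (s : 'cV[R]_d)
    (Q : probability (d.-tuple R) R) : Prop :=
  forall B : set (d.-tuple R), measurable B ->
    Q B = (\sum_i mixture_weight law s i * cond_prob law B (overload s i))%E.

(* If no node is overloaded the denominator is 0 and so is the quotient. *)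
Definition overload_ratio (law : probability (d.-tuple R) R) (s : 'cV[R]_d)
    (x : d.-tuple R) : R :=
  (\sum_j fine (law (overload s j))) / (\sum_j \1_(overload s j) x).

End network.

(* Main.v *)
Require Import Defs.
From mathcomp Require Import all_boot all_order all_algebra.
From mathcomp Require Import all_classical all_reals all_analysis.
From mathcomp Require Import measurable_realfun ring lra.
Import Order.TTheory GRing.Theory Num.Theory.
Import numFieldNormedType.Exports.
Local Open Scope classical_set_scope.
Local Open Scope ring_scope.

(** A unit vector is dual feasible and an optimal value above [k >= 0] needs an
    overloaded node, so
    [max_i P(D_i > s_i + k) <= alpha_n <= S_n := sum_i P(D_i > s_i)].
    The mixture has density [N / S_n] with respect to the law of [D], where [N]
    counts the overloaded nodes; hence [Z_n] is unbiased and [Z_n <= S_n].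
    Since [k_n = o(n^beta)], the Gaussian tails at [s_i] and [s_i + k_n] are
    logarithmically equivalent: for every [a < 1],
    [P(D_i > s_i) <= C P(D_i > s_i + k_n)^a] for large [n]. Therefore
    [E(Z_n^2) <= S_n^2 <= C' alpha_n^(2a)], and [a = 1 - eps / 2] concludes. *)

(** * Upper and lower bounds for Gaussian tails *)

Section gaussian_tail.
Context (R : realType).
Implicit Types m s x y : R.

(* For m <= x <= y, (y - m)^2 >= (x - m)^2 + (y - x)^2, so the density is
   bounded on the tail by a multiple of the one centered at x. *)
Lemma normal_tail_le m s x : 0 < s -> m <= x ->
  (normal_prob m s `]x, +oo[ <= (normal_fun m s x)%:E)%E.
Proof.
move=> s0 mx; rewrite /normal_prob.
have s1 : s != 0 by rewrite gt_eqF.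
apply: (@le_trans _ _ (\int[lebesgue_measure]_(y in `]x, +oo[)
   ((normal_fun m s x)%:E * (normal_pdf x s y)%:E)))%E.
  apply: ge0_le_integral => //=.
  - by move=> y _; rewrite lee_fin normal_pdf_ge0.
  - apply: measurable_funTS; apply/measurable_EFinP.
    exact: measurable_normal_pdf.
  - apply: measurable_funTS; apply: measurable_funeM.
    by apply/measurable_EFinP; exact: measurable_normal_pdf.
  - move=> y; rewrite in_itv/= andbT => xy.
    rewrite -EFinM lee_fin !normal_pdfE// mulrCA.
    rewrite ler_wpM2l ?normal_peak_ge0//.
    rewrite /normal_fun -expRD ler_expR -mulrDl ler_wpM2r//.
      by rewrite invr_ge0 mulrn_wge0 ?sqr_ge0.
    nra.
rewrite ge0_integralZl//=.
- rewrite -[leRHS]mule1 lee_wpmul2l ?lee_fin ?normal_fun_ge0//.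
  exact: (@probability_le1 _ _ _ (normal_prob x s)).
- apply: measurable_funTS; apply/measurable_EFinP.
  exact: measurable_normal_pdf.
- by move=> y _; rewrite lee_fin normal_pdf_ge0.
- by rewrite lee_fin normal_fun_ge0.
Qed.

(** The tail contains []x, x + 1[], where the distance to [m] is at most |x - m| + 1. This is crude,
    but on the logarithmic scale only the leading order of the exponent matters. *)
Lemma normal_tail_ge m s x : 0 < s ->
  ((normal_peak s * normal_fun 0 s (`|x - m| + 1))%:E
   <= normal_prob m s `]x, +oo[)%E.
Proof.
move=> s0; have s1 : s != 0 by rewrite gt_eqF.
apply: (@le_trans _ _ (normal_prob m s `]x, x + 1[)); last first.
  apply: (@le_measure _ _ _ (normal_prob m s)); rewrite ?inE//.
  by apply: subset_itvl.
rewrite /normal_prob.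
apply: (@le_trans _ _ (\int[lebesgue_measure]_(y in `]x, (x + 1)%R[)
   (normal_peak s * normal_fun 0 s (`|x - m| + 1))%:E))%E.
  by rewrite integral_cst//= lebesgue_measure_itv/= lte_fin ltrDl ltr01 -EFinB
    addrAC subrr add0r mule1.
apply: ge0_le_integral => //=.
- by move=> y _; rewrite lee_fin mulr_ge0 ?normal_peak_ge0 ?normal_fun_ge0.
- apply: measurable_funTS; apply/measurable_EFinP.
  exact: measurable_normal_pdf.
- move=> y; rewrite in_itv/= => /andP[xy yx].
  rewrite lee_fin normal_pdfE// ler_wpM2l ?normal_peak_ge0//.
  rewrite /normal_fun ler_expR ler_wpM2r//.
    by rewrite invr_ge0 mulrn_wge0 ?sqr_ge0.
  rewrite lerN2 subr0 -[leLHS]real_normK ?num_real// lerXn2r ?nnegrE//.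
    rewrite (_ : y - m = (x - m) + (y - x)); last by ring.
  rewrite (le_trans (ler_normD _ _))// lerD2l ger0_norm; lra.
Qed.

Lemma normal_tail_gt0 m s x : 0 < s -> (0 < normal_prob m s `]x, +oo[)%E.
Proof.
move=> s0; apply: lt_le_trans (normal_tail_ge m s x s0).
by rewrite lte_fin mulr_gt0 ?normal_peak_gt0 ?gt_eqF// expR_gt0.
Qed.

End gaussian_tail.

(** * The loss event: comparison with overloads, measurability *)

Section loss.
Context (R : realType) (d : nat).
Implicit Types (A : 'M[R]_d) (s y : 'cV[R]_d) (x : d.-tuple R) (k : R).

Lemma dual_objectiveE s y x :
  (y^T *m (\col_i tnth x i - s)) 0 0 = \sum_i y i 0 * (tnth x i - s i 0).
Proof. by rewrite !mxE; apply: eq_bigr => i _; rewrite !mxE. Qed.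

Lemma loss_eventP A s k x :
  loss_event A s k x <->
  exists2 y, dual_feasible A y & k < \sum_i y i 0 * (tnth x i - s i 0).
Proof.
split=> [/ereal_sup_gt[_ [y yA <-]]|[y yA kx]].
  by rewrite lte_fin dual_objectiveE; exists y.
rewrite /loss_event/= /dual_value; apply: (@lt_le_trans _ _
  (\sum_i y i 0 * (tnth x i - s i 0))%:E); first by rewrite lte_fin.
by apply: ereal_sup_ubound; exists y => //; rewrite dual_objectiveE.
Qed.

(** Row [j] of (I - A) e_i is [(j == i) - A j i], hence at most 1. *)
Lemma delta_dual_feasible A i :
  (forall j l, 0 <= A j l) -> dual_feasible A (delta_mx i 0).
Proof.
move=> A0; split=> j; last by rewrite mxE ler0n.
rewrite -colE !mxE; have := A0 j i; case: (j == i) => /=; lra.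
Qed.

(** The unit vector at [i] has objective [tnth x i - s i 0]; this is the source of the lower bound
    on the loss probability. *)
Lemma coord_loss_event A s k i x : (forall j l, 0 <= A j l) ->
  s i 0 + k < tnth x i -> loss_event A s k x.
Proof.
move=> A0 sx; apply/loss_eventP; exists (delta_mx i 0).
  exact: delta_dual_feasible.
rewrite (bigD1 i)//= big1 ?addr0 => [|j ji].
  by rewrite mxE !eqxx mul1r ltrBrDl.
by rewrite mxE (negbTE ji) mul0r.
Qed.

(** Without overload every term [y i 0 * (tnth x i - s i 0)] is nonpositive, so no feasible
    objective exceeds [k]. *)
Lemma loss_event_overload A s k x : 0 <= k ->
  loss_event A s k x -> exists i, overload s i x.
Proof.
move=> k0 /loss_eventP[y [_ y0] kx].
suff [i xi] : exists i, 0 < tnth x i - s i 0 by exists i.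
apply/existsP; move: kx; apply: contraLR; rewrite negb_exists => /forallP xs.
rewrite -leNgt (le_trans _ k0)// sumr_le0// => i _.
by rewrite mulr_ge0_le0// leNgt.
Qed.

Lemma measurable_overload s i : measurable (overload s i).
Proof.
rewrite (_ : overload s i = (fun x => tnth x i) @^-1` `]s i 0, +oo[).
  by rewrite -[X in measurable X]setTI; apply: measurable_tnth.
by apply/seteqP; split=> x /=; rewrite in_itv/= andbT /overload/= subr_gt0.
Qed.

(* The supremum over the polyhedron reduces to a countable supremum, one
   feasible point being chosen in each box with rational center and
   inverse-integer radius. *)
Lemma measurable_loss_event A s k : measurable (loss_event A s k).
Proof.
pose box (c : {ffun 'I_d -> rat} * nat) : set 'cV[R]_d :=
  [set y | forall i, `|y i 0 - ratr (c.1 i)| < c.2.+1%:R^-1].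
(* The union has a constant body and serves as a guard: it is empty when the box misses the feasible
   set, where [get] would return a default point. *)
pose F c : set (d.-tuple R) := \bigcup_(_ in dual_feasible A `&` box c)
   [set x | k < \sum_i (get (dual_feasible A `&` box c)) i 0
                       * (tnth x i - s i 0)].
have -> : loss_event A s k = \bigcup_c F c.
  apply/seteqP; split=> [x /loss_eventP[y yA kx]|x [c _ [y [yA yc]]] /=].
  - pose M := \sum_i `|tnth x i - s i 0|.
    have M0 : 0 <= M by rewrite sumr_ge0.
    (* Moving each coordinate of [y] by at most [g] changes the objective by at most [g * M], less
       than its excess [g * (M + 1)] over [k]. *)
    pose g := (\sum_i y i 0 * (tnth x i - s i 0) - k) / (M + 1).
    have g0 : 0 < g by rewrite divr_gt0 ?subr_gt0// ltr_wpDl.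
    (* Two points of one box differ by at most 2 / (n + 1) per coordinate; this [n] makes that less
       than [g]. *)
    pose n := Num.bound (2 / g).
    have ng : 2 * n.+1%:R^-1 < g.
      have : 2 / g < n%:R by apply: archi_boundP; rewrite divr_ge0// ltW.
      rewrite !ltr_pdivrMr ?ltr0n// -natr1; nra.
    have /choice[q qy] : forall i, exists q, `|y i 0 - ratr q| < n.+1%:R^-1.
      move=> i; have /rat_in_itvoo[q] : y i 0 - n.+1%:R^-1 < y i 0 + n.+1%:R^-1.
        by rewrite ltrD2l gtrN// invr_gt0.
      rewrite in_itv/= => /andP[q1 q2]; exists q.
      by rewrite ltr_distlC q1 q2.
    pose c := ([ffun i => q i], n).
    have yc : (dual_feasible A `&` box c) y.
      by split=> // i; rewrite /c/= ffunE.
    exists c => //; exists y => //.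
    suff zx (z : 'cV[R]_d) : box c z -> k < \sum_i z i 0 * (tnth x i - s i 0).
      by have [_ zc] := getI yc; exact: zx.
    move=> zc.
    have zy i : `|y i 0 - z i 0| <= 2 * n.+1%:R^-1.
      have : `|z i 0 - ratr (q i)| < n.+1%:R^-1 by have := zc i; rewrite ffunE.
      move=> zq; rewrite mulr_natl mulr2n.
      rewrite (le_trans (ler_distD (ratr (q i)) _ _))//.
      by rewrite lerD// ltW// distrC.
    have : \sum_i (y i 0 - z i 0) * (tnth x i - s i 0) <= 2 * n.+1%:R^-1 * M.
      rewrite /M mulr_sumr ler_sum// => i _.
      by rewrite (le_trans (ler_norm _))// normrM ler_wpM2r.
    under eq_bigr do rewrite mulrBl.
    rewrite sumrB => h.
    have gM : g * (M + 1) = \sum_i y i 0 * (tnth x i - s i 0) - k.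
      by rewrite /g divfK// gt_eqF// ltr_wpDl.
    have {h} := le_trans h (ler_wpM2r M0 (ltW ng)); rewrite lerBlDr => h.
    rewrite -(ltrD2l (g * M)) (lt_le_trans _ h)// -ltrBrDr -gM.
    by rewrite mulrDr mulr1 ltrDl.
  - move=> kx; apply/loss_eventP.
    exists (get (dual_feasible A `&` box c)) => //.
    have yAc : (dual_feasible A `&` box c) y by [].
    by have [] := getI yAc.
apply: countable_bigcupT_measurable => // c.
rewrite /F; have [->|/set0P[y0 yA]] := eqVneq (dual_feasible A `&` box c) set0.
  by rewrite bigcup_set0.
set z := get _; rewrite [X in measurable X](_ : _ =
  (fun x => \sum_i z i 0 * (tnth x i - s i 0)) @^-1` `]k, +oo[); last first.
  apply/seteqP; split=> x /=; rewrite in_itv/= andbT; first by case.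
  by move=> kx; exists y0.
rewrite -[X in measurable X]setTI.
apply: measurable_sum => //= i.
apply: measurable_funM => //; apply: measurable_funB => //.
exact: measurable_tnth.
Qed.

End loss.

(** * Integration against restricted measures and finite sums of measures *)

Section mixture.
Context (disp : measure_display) (T : measurableType disp) (R : realType).
Local Open Scope ereal_scope.

(** Split [E] along [D]: the restricted measure agrees with [mu] inside [D] and vanishes outside. *)
Lemma ge0_integral_mrestr (mu : {measure set T -> \bar R}) (D E : set T)
    (mD : measurable D) (f : T -> \bar R) :
  measurable E -> measurable_fun E f -> (forall x, E x -> 0 <= f x) ->
  \int[mrestr mu mD]_(x in E) f x = \int[mu]_(x in E `&` D) f x.
Proof.
move=> mE mf f0; rewrite -{1}(setUIDK E D) ge0_integral_setU//=.
- rewrite (eq_measure_integral mu) => [|A mA AED]; last first.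
    by rewrite /= /mrestr setIidl// => x /AED[].
  rewrite [X in _ + X](eq_measure_integral mzero) => [|A mA AED]; last first.
    rewrite /= /mrestr /mzero (_ : A `&` D = set0) ?measure0//.
    by apply/seteqP; split=> // x [/AED[]].
  by rewrite integral_measure_zero adde0.
- exact: measurableI.
- exact: measurableD.
- by rewrite setUIDK.
- by move=> x [[Ex _]|[Ex _]]; exact: f0.
- by apply/disj_setPS => x [[_ Dx] [_]].
Qed.

Lemma ge0_integral_sum_measure (I : finType)
    (m : I -> {measure set T -> \bar R}) (nu : {measure set T -> \bar R})
    (E : set T) (f : T -> \bar R) :
  (forall A, measurable A -> nu A = \sum_i m i A) ->
  measurable E -> measurable_fun E f -> (forall x, E x -> 0 <= f x) ->
  \int[nu]_(x in E) f x = \sum_i \int[m i]_(x in E) f x.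
Proof.
move=> num mE mf f0.
(* The family is enumerated as a sequence, so that [msum] applies; indices out of range get
   [mzero]. *)
pose m_ n : {measure set T -> \bar R} :=
  if insub n is Some j then m (@enum_val I predT j) else mzero.
rewrite (eq_measure_integral (msum m_ #|I|)) => [|A mA _].
  rewrite ge0_integral_measure_sum//.
  rewrite (reindex _ (onW_bij _ (@enum_val_bij I)))/=.
  by apply: eq_bigr => i _; rewrite /m_ valK.
rewrite num// /msum/= (reindex _ (onW_bij _ (@enum_val_bij I)))/=.
by apply: eq_bigr => i _; rewrite /m_ valK.
Qed.

End mixture.

(** * The mixture as sampling law: density, mean and second moment *)

Section importance_sampling.
Context (R : realType) (d : nat) (law Q : probability (d.-tuple R) R).
Context (s : 'cV[R]_d) (d_gt0 : (0 < d)%N).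
Hypothesis overload_gt0 : forall i, (0 < law (overload s i))%E.
Hypothesis QE : is_mixture law s Q.

Let S := \sum_j fine (law (overload s j)).

Let overloadE i : law (overload s i) = (fine (law (overload s i)))%:E.
Proof. by rewrite fineK ?fin_num_measure//; exact: measurable_overload. Qed.

Let fine_overload_gt0 i : 0 < fine (law (overload s i)).
Proof. by rewrite -lte_fin -overloadE. Qed.

Lemma sum_overload_gt0 : 0 < S.
Proof.
rewrite /S (bigD1 (Ordinal d_gt0))//= ltr_pwDl ?fine_overload_gt0//.
by rewrite sumr_ge0// => i _; rewrite ltW.
Qed.

(** The overload probability in each weight cancels the conditioning denominator, leaving the common
    factor 1 / S. *)
Lemma mixtureE B : measurable B ->
  Q B = (\sum_i S^-1%:E * law (B `&` overload s i))%E.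
Proof.
move=> mB; rewrite QE//; apply: eq_bigr => i _.
rewrite /mixture_weight /cond_prob.
rewrite (eq_bigr _ (fun j _ => overloadE j)) sumEFin -/S overloadE.
have -> : law (B `&` overload s i) = (fine (law (B `&` overload s i)))%:E.
  rewrite fineK ?fin_num_measure//; apply: measurableI => //.
  exact: measurable_overload.
rewrite !inver !gt_eqF ?sum_overload_gt0//.
rewrite -!EFinM; congr EFin; set p := fine (law (overload s i)).
have p0 : p != 0 by rewrite lt0r_neq0// fine_overload_gt0.
by rewrite mulrCA mulrAC divff// mul1r mulrC.
Qed.

Lemma overload_ratio_ge0 x : 0 <= overload_ratio law s x.
Proof.
rewrite /overload_ratio divr_ge0 ?(ltW sum_overload_gt0)//.
by rewrite sumr_ge0.
Qed.

(** One overloaded node already makes the denominator at least 1; with none, the ratio is 0 by the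
    convention for division by 0. *)
Lemma overload_ratio_le x : overload_ratio law s x <= S.
Proof.
have S0 := ltW sum_overload_gt0.
rewrite /overload_ratio -/S; have [/existsP[i xi]|] :=
  boolP [exists i, x \in overload s i].
  have N1 : 1 <= \sum_j \1_(overload s j) x :> R.
    by rewrite (bigD1 i)//= indicE xi lerDl sumr_ge0.
  by rewrite ler_pdivrMr ?(lt_le_trans _ N1)// ler_peMr.
rewrite negb_exists => /forallP xN; rewrite big1 ?invr0 ?mulr0// => i _.
by rewrite indicE (negbTE (xN i)).
Qed.

Lemma measurable_overload_ratio :
  measurable_fun [set: d.-tuple R] (overload_ratio law s).
Proof.
(* The power -1 agrees with the inverse on nonnegative reals, 0 included, and [measurable_powR]
   applies to it. *)
rewrite (_ : overload_ratio law s =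
  fun x => S * (\sum_j \1_(overload s j) x) `^ (-1)); last first.
  by apply/funext => x; rewrite powR_inv1// sumr_ge0.
apply: measurable_funM => //.
apply: (measurableT_comp (measurable_powR _)) => //.
apply: measurable_sum => i; apply: measurable_indic.
exact: measurable_overload.
Qed.

Context (E : set (d.-tuple R)) (mE : measurable E).
Hypothesis E_overload : forall x, E x -> exists i, overload s i x.

Let Z x := overload_ratio law s x * \1_E x.

Lemma measurable_estimator : measurable_fun [set: d.-tuple R] Z.
Proof.
by apply: measurable_funM;
  [exact: measurable_overload_ratio | exact: measurable_indic].
Qed.

Let Z_ge0 x : 0 <= Z x.
Proof. by rewrite mulr_ge0 ?overload_ratio_ge0. Qed.

(* Multiplying by the number of overloaded nodes cancels the denominator of
   the ratio; on E this number is at least 1. *)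
Lemma sum_estimator_overload x : \sum_i Z x * \1_(overload s i) x = S * \1_E x.
Proof.
rewrite -mulr_sumr /Z /overload_ratio -/S; have [xE|xE] := boolP (x \in E).
  rewrite indicE xE !mulr1 divfK// gt_eqF//.
  have [i xi] := E_overload _ (set_mem xE).
  by rewrite (bigD1 i)//= indicE mem_set// ltr_pwDl// sumr_ge0.
by rewrite indicE (negbTE xE) !mulr0 mul0r.
Qed.

(** Integrating [Z] against each component inserts the indicator of that overload; by
    [sum_estimator_overload] these add up to [S * \1_E], and the factor 1 / S disappears. *)
Lemma integral_estimator B : measurable B ->
  (\int[Q]_(x in B) (Z x)%:E = law (B `&` E))%E.
Proof.
move=> mB; have mZ := measurable_estimator.
have S0 : 0 <= S^-1 by rewrite invr_ge0 ltW// sum_overload_gt0.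
have mO i := measurable_overload _ _ s i.
(* The components of the mixture: [law] restricted to one overload, scaled by 1 / S. *)
pose m i : {measure set (d.-tuple R) -> \bar R} :=
  mscale (NngNum S0) (mrestr law (mO i)).
rewrite (@ge0_integral_sum_measure _ _ _ _ m)//; first last.
- by move=> x _; rewrite lee_fin.
- by apply/measurable_funTS/measurable_EFinP.
- by move=> A mA; exact: mixtureE.
transitivity (\sum_(i < d)
    S^-1%:E * \int[law]_(x in B) (Z x * \1_(overload s i) x)%:E)%E.
  apply: eq_bigr => i _.
  rewrite ge0_integral_mscale//; first last.
  - by move=> x _; rewrite lee_fin.
  - by apply/measurable_funTS/measurable_EFinP.
  congr (_ * _)%E; rewrite ge0_integral_mrestr//; first last.
  - by move=> x _; rewrite lee_fin.
  - by apply/measurable_funTS/measurable_EFinP.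
  rewrite integral_mkcondr; apply: eq_integral => x _.
  by rewrite patchE indicE; case: ifP; rewrite ?mulr1 ?mulr0.
rewrite -ge0_sume_distrr; last first.
  by move=> i _; apply: integral_ge0 => x _; rewrite lee_fin mulr_ge0.
rewrite -ge0_integral_sum//; first last.
- by move=> i x _; rewrite lee_fin mulr_ge0.
- move=> i; apply/measurable_funTS/measurable_EFinP/measurable_funM => //.
under eq_integral do rewrite sumEFin sum_estimator_overload EFinM.
rewrite ge0_integralZl//; first last.
- by rewrite lee_fin ltW// sum_overload_gt0.
- by apply/measurable_funTS/measurable_EFinP/measurable_indic.
rewrite integral_indic// muleA -EFinM mulVf ?gt_eqF ?sum_overload_gt0//.
by rewrite mul1e setIC.
Qed.

(** By [integral_estimator], [Z] integrates over every measurable set to the restriction of [law] to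
    [E]. This gives domination, and equality with the Radon-Nikodym derivative since equal integrals
    force equality almost everywhere. *)
Lemma density_on_overload_ratio : density_on law Q E (overload_ratio law s).
Proof.
exists mE => mu_E.
have dom : mu_E `<< Q.
  apply/null_content_dominatesP => A mA QA0.
  rewrite /mu_E/= /mfrestr /mrestr/= -integral_estimator//.
  apply: null_set_integral => //.
  by apply/measurable_funTS/measurable_EFinP; exact: measurable_estimator.
split=> //; apply: integral_ae_eq => //.
- exact: Radon_Nikodym_integrable.
- by apply/measurable_EFinP; exact: measurable_estimator.
- move=> A _ mA; rewrite -Radon_Nikodym_integral//=.
  by rewrite integral_estimator.
Qed.

Lemma expectation_estimator : 'E_Q[Z]%E = law E.
Proof. by rewrite unlock integral_estimator// setTI. Qed.

(** Pointwise 0 <= Z <= S, and [Q] has mass 1. *)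
Lemma expectation_sqr_estimator :
  ('E_Q[fun x => (Z x ^+ 2)%R] <= (S ^+ 2)%:E)%E.
Proof.
rewrite -[leRHS](expectation_cst Q); apply: expectation_le => //.
- by apply: measurable_funX; exact: measurable_estimator.
- by move=> x; rewrite sqr_ge0.
- by move=> x; rewrite sqr_ge0.
- apply: aeW => x; rewrite lerXn2r ?nnegrE ?(ltW sum_overload_gt0)//.
  rewrite /Z indicE (le_trans _ (overload_ratio_le x))// ler_piMr//.
  + exact: overload_ratio_ge0.
  + by rewrite lern1 leq_b1.
Qed.

End importance_sampling.

(** * Logarithmic comparison of shifted tails as n grows *)

Section asymptotics.
Context (R : realType).
Implicit Types m s a r x y : R.

(** The two tail bounds reduce the claim to exponents: a (|y - m| + 1)^2 <= (r (|y - m| + 1))^2 <=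
    (x - m)^2. The peak factor comes from the lower bound. *)
Lemma normal_tail_compare m s a r x y : 0 < s -> 0 <= a -> 0 <= r ->
  a <= r ^+ 2 -> m <= x -> r * (`|y - m| + 1) <= x - m ->
  normal_peak s `^ a * fine (normal_prob m s `]x, +oo[)
  <= fine (normal_prob m s `]y, +oo[) `^ a.
Proof.
move=> s0 a0 r0 ar mx rxy.
have pk : 0 < normal_peak s by rewrite normal_peak_gt0// gt_eqF.
have fin z : normal_prob m s `]z, +oo[ =
    (fine (normal_prob m s `]z, +oo[))%:E.
  by rewrite fineK// fin_num_measure.
have Tx : fine (normal_prob m s `]x, +oo[) <= normal_fun m s x.
  by rewrite -lee_fin -fin normal_tail_le.
have Ty : normal_peak s * normal_fun 0 s (`|y - m| + 1)
    <= fine (normal_prob m s `]y, +oo[).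
  by rewrite -lee_fin -fin normal_tail_ge.
apply: (@le_trans _ _ ((normal_peak s * normal_fun 0 s (`|y - m| + 1)) `^ a)).
  rewrite powRM ?(ltW pk) ?normal_fun_ge0// ler_wpM2l ?powR_ge0//.
  rewrite (le_trans Tx)// /normal_fun -expRM ler_expR subr0 [leRHS]mulrC mulrA.
  rewrite ler_wpM2r ?invr_ge0 ?mulrn_wge0 ?sqr_ge0// mulrN lerN2.
  apply: (@le_trans _ _ ((r * (`|y - m| + 1)) ^+ 2)).
    by rewrite exprMn ler_wpM2r// sqr_ge0.
  by rewrite lerXn2r// ?nnegrE ?subr_ge0// mulr_ge0// addr_ge0.
by apply: ge0_ler_powR => //; rewrite nnegrE ?fine_ge0// mulr_ge0 ?(ltW pk)
  ?normal_fun_ge0.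
Qed.

Lemma normal_tail_shift m s (c a : R) (v k : nat -> R) : 0 < s -> 0 < c ->
  0 < a < 1 ->
  (forall M, exists N, forall n, (N < n)%N -> M < v n) ->
  little_o k v -> (forall n, (0 < n)%N -> 0 <= k n) ->
  exists N, forall n, (N < n)%N ->
    normal_peak s `^ a * fine (normal_prob m s `]v n * c, +oo[)
    <= fine (normal_prob m s `]v n * c + k n, +oo[) `^ a.
Proof.
move=> s0 c0 /andP[a0 a1] vy kv k0.
(* Then [r < 1], and r^2 - a = ((1 - a) / 2)^2 >= 0. *)
pose r := (1 + a) / 2.
have r0 : 0 < r by rewrite /r; lra.
have r1 : r < 1 by rewrite /r; lra.
(* The slack [b * v n] is shared: one half absorbs [k n], the other absorbs 1 + |m|. *)
pose b := (1 - r) * c.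
have b0 : 0 < b by rewrite mulr_gt0// subr_gt0.
have [N1 kN] := kv (b / 2) (divr_gt0 b0 (ltr0Sn _ 1)).
have [N2 vN] := vy (2 * (1 + `|m|) / b).
exists (maxn N1 N2) => n; rewrite gtn_max => /andP[nN1 nN2].
have := kN _ nN1; have := vN _ nN2.
have kn0 := k0 _ (leq_ltn_trans (leq0n _) nN1).
rewrite ltr_pdivrMr// => vn; rewrite ger0_norm//.
have m0 : 0 <= `|m| by []. have mm := ler_norm m.
have vn0 : 0 < v n by rewrite -(pmulr_lgt0 _ b0) (lt_trans _ vn)//; lra.
rewrite (gtr0_norm vn0) => kn.
move: mm m0 vn kn; rewrite /b; set w := v n * c => mm m0 vn kn.
have wr : v n * ((1 - r) * c) = (1 - r) * w by rewrite /w; ring.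
rewrite wr in vn.
have kn' : k n < (1 - r) * w / 2.
  by rewrite -wr (lt_le_trans kn)// le_eqVlt; apply/orP; left; apply/eqP; ring.
have w0 : 0 < w by rewrite mulr_gt0.
have mw : m <= w by nra.
apply: (@normal_tail_compare _ _ _ r) => //; rewrite ?ltW//.
  by rewrite /r; nra.
rewrite ger0_norm; last by lra.
nra.
Qed.

Lemma powR_natr_unbounded (beta : R) : 0 < beta ->
  forall M : R, exists N, forall n, (N < n)%N -> M < n%:R `^ beta.
Proof.
move=> b0 M; pose M1 := `|M| + 1.
exists (Num.bound (M1 `^ beta^-1)) => n Nn.
have Mn : M1 `^ beta^-1 < n%:R.
  by rewrite (lt_trans (archi_boundP _)) ?powR_ge0// ltr_nat.
rewrite (@lt_le_trans _ _ M1)//; first by rewrite /M1; have := ler_norm M; lra.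
have -> : M1 = (M1 `^ beta^-1) `^ beta.
  by rewrite -powRrM mulVf ?gt_eqF// powRr1// addr_ge0.
by apply: ge0_ler_powR; rewrite ?nnegrE ?powR_ge0// ltW.
Qed.

(** Optimality asks for a bound over all positive [n], while tail comparison works only beyond some
    [N]; the finitely many earlier terms are bounded one by one. *)
Lemma ereal_sup_seq_lty (u : nat -> \bar R) (N : nat) (K : R) :
  (forall n, (0 < n)%N -> (u n < +oo)%E) ->
  (forall n, (N < n)%N -> (u n <= K%:E)%E) ->
  (ereal_sup [set u n | n in [set n | (0 < n)%N]] < +oo)%E.
Proof.
move=> uy uK.
have [M [KM uM]] : exists M : R, K <= M /\
    forall n, (0 < n <= N)%N -> (u n <= M%:E)%E.
  elim: {uK} N => [|N [M [KM uM]]].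
    by exists K; split=> // n; rewrite leqn0 => /andP[/[swap] /eqP->].
  have [x ux] : exists x : R, (u N.+1 <= x%:E)%E.
    have := uy N.+1 isT; case: (u N.+1) => [x _| //|_]; first by exists x.
    by exists 0; rewrite leNye.
  exists (Num.max M x); split; first by rewrite le_max KM.
  move=> n /andP[n0]; rewrite leq_eqVlt => /predU1P[->|nN].
    by rewrite (le_trans ux)// lee_fin le_max lexx orbT.
  by rewrite (le_trans (uM n _)) ?n0// lee_fin le_max lexx.
apply: (@le_lt_trans _ _ M%:E); last exact: ltry.
apply: ge_ereal_sup => _ [n n0 <-].
have [nN|Nn] := leqP n N; first by rewrite uM// n0.
by rewrite (le_trans (uK n Nn))// lee_fin.
Qed.

End asymptotics.

(** * Unbiasedness and the uniform bound on the relative second moment *)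

Theorem theorem5 (R : realType) (d : nat) (d_gt0 : (0 < d)%N)
  (* network *)
  (edge : rel 'I_d) (edge_irr : irreflexive edge)
  (H_irred : irreducible_mx (incidence_mx R edge))
  (A : 'M[R]_d)
  (A_zero : forall i j, incidence_mx R edge i j = 0 -> A i j = 0)
  (A_pos : forall i j, incidence_mx R edge i j = 1 -> 0 < A i j)
  (A_sum : forall i, \sum_j A i j = 1)
  (* supplies and demands *)
  (gamma mu sigma : 'I_d -> R)
  (gamma_gt0 : forall i, 0 < gamma i)
  (mu_gt0 : forall i, 0 < mu i)
  (sigma_gt0 : forall i, 0 < sigma i)
  (Sigma : 'M[R]_d)
  (Sigma_diag : forall i, Sigma i i = sigma i ^+ 2)
  (Sigma_spd : spd_mx Sigma)
  (disp : measure_display) (Omega : measurableType disp)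
  (P : probability Omega R)
  (D : {RV P >-> d.-tuple R})
  (D_gauss : jointly_gaussian P D)
  (D_law : forall i,
     has_law P (fun w => tnth (D w) i) (normal_prob (mu i) (sigma i)))
  (D_cov : forall i j,
     covariance P (fun w => tnth (D w) i) (fun w => tnth (D w) j)
     = (Sigma i j)%:E)
  (* rare-event regime *)
  (beta : R) (beta_gt0 : 0 < beta)
  (k : nat -> R) (k_ge0 : forall n, (0 < n)%N -> 0 <= k n)
  (k_small : little_o k (fun n => n%:R `^ beta))
  (* importance sampling law *)
  (Q : nat -> probability (d.-tuple R) R)
  (Q_def : forall n, (0 < n)%N ->
     is_mixture (distribution P D) (supply beta gamma n) (Q n)) :
  let law : probability (d.-tuple R) R := distribution P D in
  let s := supply beta gamma in
  let E n := loss_event A (s n) (k n) in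
  let alpha n := fine (P (D @^-1` E n)) in
  let Z n x := overload_ratio law (s n) x * \1_(E n) x in
  (forall n, (0 < n)%N ->
     density_on law (Q n) (E n) (overload_ratio law (s n))) /\
  asymptotically_optimal Q Z alpha.
Proof.
move=> law s E alpha Z.
have A_ge0 i j : 0 <= A i j.
  have [eij|eij] := boolP (edge i j).
    by apply: ltW; apply: A_pos; rewrite mxE eij.
  by rewrite A_zero// mxE (negbTE eij).
have law_tail i x : law [set z | x < tnth z i] =
    normal_prob (mu i) (sigma i) `]x, +oo[.
  rewrite -D_law//; congr (P _).
  by apply/seteqP; split=> w /=; rewrite in_itv/= andbT.
have law_overload n i : law (overload (s n) i) =
    normal_prob (mu i) (sigma i) `](n%:R `^ beta * gamma i), +oo[.
  rewrite -law_tail; congr (law _).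
  by apply/seteqP; split=> w /=; rewrite /overload/= subr_gt0 mxE.
have overload_gt0 n i : (0 < law (overload (s n) i))%E.
  by rewrite law_overload; exact: normal_tail_gt0.
have mE n : measurable (E n) by exact: measurable_loss_event.
have E_overload n : (0 < n)%N ->
    forall x, E n x -> exists i, overload (s n) i x.
  by move=> n0 x; exact: loss_event_overload (k_ge0 n n0).
have law_E n : law (E n) = (alpha n)%:E.
  by rewrite /alpha -[P _]/(law (E n)) fineK// fin_num_measure.
have alpha_ge n i : fine (normal_prob (mu i) (sigma i)
    `](n%:R `^ beta * gamma i + k n), +oo[) <= alpha n.
  rewrite -lee_fin -law_E fineK ?fin_num_measure// -law_tail.
  apply: le_measure; rewrite ?inE//.
    rewrite -[X in measurable X]setTI.
    rewrite (_ : [set z : d.-tuple R | _] = (fun z => tnth z i) @^-1`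
      `](n%:R `^ beta * gamma i + k n), +oo[); first exact: measurable_tnth.
    by apply/seteqP; split=> w /=; rewrite in_itv/= andbT.
  by move=> x /= kx; apply: (@coord_loss_event _ _ _ _ _ i) => //; rewrite mxE.
have alpha_gt0 n : 0 < alpha n.
  apply: lt_le_trans (alpha_ge n (Ordinal d_gt0)).
  by rewrite -lte_fin fineK ?fin_num_measure//; exact: normal_tail_gt0.
have alpha_le1 n : alpha n <= 1 by rewrite -lee_fin -law_E probability_le1.
split=> [n n0|].
  by apply: density_on_overload_ratio => //; [exact: Q_def|exact: E_overload].
split=> [n n0|eps eps0].
  split; first exact: measurable_estimator.
  rewrite -law_E; apply: expectation_estimator => //.
    exact: Q_def.
  exact: E_overload.
(* Capping [eps] at 1 keeps [a] positive when [eps] is large. *)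
pose e := Num.min eps 1; pose a := 1 - e / 2.
have e0 : 0 < e by rewrite lt_min eps0 ltr01.
have e1 : e <= 1 by rewrite ge_min lexx orbT.
have ee : e <= eps by rewrite ge_min lexx.
have a01 : 0 < a < 1 by rewrite /a; apply/andP; split; lra.
(* Each node has its own threshold; their maximum serves all nodes in [S_le]. *)
have /choice[N_ NP] : forall i, exists N, forall n, (N < n)%N ->
    normal_peak (sigma i) `^ a * fine (law (overload (s n) i)) <= alpha n `^ a.
  move=> i; have [N NP] := @normal_tail_shift _ (mu i) (sigma i) (gamma i) a _ k
    (sigma_gt0 i) (gamma_gt0 i) a01 (powR_natr_unbounded _ _ beta_gt0) k_small
    k_ge0.
  exists N => n nN; rewrite law_overload (le_trans (NP n nN))//.
  apply: ge0_ler_powR; rewrite ?nnegrE ?fine_ge0 ?(ltW (alpha_gt0 _))//.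
  by case/andP: a01 => /ltW.
pose K := \sum_i (normal_peak (sigma i) `^ a)^-1.
have S_le n : (\max_i N_ i < n)%N ->
    \sum_i fine (law (overload (s n) i)) <= K * alpha n `^ a.
  move=> nN; rewrite /K mulr_suml ler_sum// => i _.
  have pk : 0 < normal_peak (sigma i) `^ a.
    by rewrite powR_gt0// normal_peak_gt0// gt_eqF.
  rewrite -[leLHS](mulKf (lt0r_neq0 pk)) ler_wpM2l ?invr_ge0 ?(ltW pk)// NP//.
  by rewrite (leq_ltn_trans _ nN)//; exact: leq_bigmax.
have S_ge0 n : 0 <= \sum_i fine (law (overload (s n) i)).
  by rewrite sumr_ge0// => i _; rewrite fine_ge0.
have quotient_le n (M : R) :
    (\sum_i fine (law (overload (s n) i))) ^+ 2 <= M * alpha n `^ (2 - eps) ->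
    ('E_(Q n)[(fun x => (Z n x) ^+ 2)%R] / (alpha n `^ (2 - eps))%:E
      <= M%:E)%E.
  move=> SM; have pa : 0 < alpha n `^ (2 - eps) by rewrite powR_gt0.
  rewrite inver gt_eqF// lee_pdivrMr//.
  apply: le_trans (expectation_sqr_estimator _ _ law _ (s n) d_gt0 _ _ _) _;
    by rewrite ?lee_fin.
apply: (@ereal_sup_seq_lty _ _ (\max_i N_ i) (K ^+ 2)) => n.
  (* For a single [n] finiteness is enough, so the bound may depend on [n]. *)
  move=> n0; pose M := (\sum_i fine (law (overload (s n) i))) ^+ 2
    / alpha n `^ (2 - eps).
  apply: (@le_lt_trans _ _ M%:E); last exact: ltry.
  by apply: quotient_le; rewrite /M divfK// gt_eqF// powR_gt0.
move=> nN.
apply: quotient_le.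
have K0 : 0 <= K by rewrite sumr_ge0// => i _; rewrite invr_ge0 powR_ge0.
apply: (@le_trans _ _ ((K * alpha n `^ a) ^+ 2)).
  by rewrite lerXn2r ?nnegrE// ?mulr_ge0 ?powR_ge0// S_le.
(* Since 2 a = 2 - e >= 2 - eps and 0 < alpha <= 1, the power 2 a of [alpha n] is the smaller
   one. *)
rewrite exprMn ler_wpM2l ?sqr_ge0// -powR_mulrn ?powR_ge0// -powRrM.
by apply: ger_powR; rewrite ?alpha_gt0 ?alpha_le1// /a; lra.
Qed.
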